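(* Let $(X,d)$ be a metric space and let $\mathscr{B}$ be a bornology on $X$ with a closed base $\mathscr{S}$. The following statements are equivalent. (1) $\mathscr{T}_{\mathscr{B}}$ on $C(X)$ is completely metrizable. (2) The space $(C(X),\mathscr{T}_{\mathscr{B}})$ is sieve complete. (3) The space $(C(X),\mathscr{T}_{\mathscr{B}})$ is almost complete. (4) The space $(C(X),\mathscr{T}_{\mathscr{B}})$ is pseudo-complete and a $\sigma$-space. (5) The space $(C(X),\mathscr{T}_{\mathscr{B}})$ is a pseudo-complete space with at least one $q_D$-point for some dense subset $D\subseteq C(X)$.
   Context: A bornology $\mathscr{B}$ on a nonempty set $X$ is a family of nonempty subsets of $X$ that covers $X$ and is closed under taking finite unions and under taking (nonempty) subsets. A subfamily $\mathscr{S}\subseteq\mathscr{B}$ is a base of $\mathscr{B}$ if each $B\in\mathscr{B}$ is contained in some $A\in\mathscr{S}$; it is a closed base if moreover every member of $\mathscr{S}$ is a closed subset of $X$. $C(X)$ is the set of continuous functions from $X$ to $\mathbb{R}$. The topology $\mathscr{T}_{\mathscr{B}}$ of uniform convergence on $\mathscr{B}$ is the topology on $C(X)$ induced by the uniformity having as a base of entourages all sets $[B;\varepsilon]=\{(f,g)\in C(X)\times C(X): |f(x)-g(x)|<\varepsilon \text{ for all } x\in B\}$, where $B\in\mathscr{B}$ and $\varepsilon>0$. Let $T$ be a topological space. A family of subsets of $T$ is an almost cover if its union is dense in $T$. A sieve (resp. almost sieve) $\langle\{U_i:i\in I_n\},\pi_n:n\ge1\rangle$ on $T$ is a sequence of indexed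 covers (resp. almost covers) $\{U_i:i\in I_n\}$ of $T$ together with maps $\pi_n:I_{n+1}\to I_n$ such that for all $n\ge1$ and $i\in I_n$, $U_i=\bigcup\{U_j:j\in\pi_n^{-1}(i)\}$ (resp. $\bigcup\{U_j:j\in\pi_n^{-1}(i)\}$ is a dense subset of $U_i$). It is open if all $U_i$ are open. A $\pi$-chain is a sequence $\langle i_n:n\ge1\rangle$ with $i_n\in I_n$ and $\pi_n(i_{n+1})=i_n$ for all $n\ge1$. A filterbase $\mathscr{F}$ on $T$ is controlled by a sequence $\langle U_n:n\ge1\rangle$ of subsets if each $U_n$ contains some $F\in\mathscr{F}$. A sequence $\langle U_n:n\ge1\rangle$ is complete if each filterbase controlled by it clusters, i.e. has a cluster point in $T$ (a point in $\bigcap_{F\in\mathscr{F}}\overline{F}$). $T$ is sieve complete (resp. almost complete) if there is an open sieve (resp. open almost sieve) on $T$ such that $\langle U_{i_n}:n\ge1\rangle$ is a complete sequence for each $\pi$-chain $\langle i_n:n\ge1\rangle$. $T$ is pseudo-complete if it has a sequence $\langle\mathscr{B}_n:n\ge1\rangle$ of $\pi$-bases (families of nonempty open sets such that every nonempty open set contains a member) such that $\bigcap_{n\ge1}V_n\neq\emptyset$ whenever $\overline{V_{n+1}}\subseteq V_n\in\mathscr{B}_n$ for each $n\ge1$. $T$ is a $\sigma$-space if it has a $\sigma$-discrete network. Let $D$ be a dense subset of $T$. A point $x\in T$ is a $q_D$-point of $T$ if there is a sequence $\langle U_n:n\ge1\rangle$ of open neighborhoods of $x$ such that every sequence $\langle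 x_n:n\ge1\rangle$ with $x_n\in U_n\cap D$ for all $n\ge1$ has a cluster point in $T$. In (5), density is with respect to $\mathscr{T}_{\mathscr{B}}$. *)

(* Defs.v *)
From HB Require Import structures.
From mathcomp Require Import all_boot all_order all_algebra finmap.
From mathcomp Require Import all_classical all_reals all_analysis.

Set Implicit Arguments.
Unset Strict Implicit.
Unset Printing Implicit Defensive.

Import Order.TTheory GRing.Theory Num.Theory.
Import numFieldNormedType.Exports.

Local Open Scope classical_set_scope.
Local Open Scope ring_scope.

Section Bornology.
Context {X : topologicalType}.
Implicit Types B S : set_system X.

Definition bornology B :=
  [/\ B `<=` [set A | A !=set0],
      \bigcup_(A in B) A = [set: X],
      setU_closed B &
      forall A C : set X, B A -> C `<=` A -> C !=set0 -> B C].

Definition base_of B S :=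
  S `<=` B /\ forall A, B A -> exists2 C, S C & A `<=` C.

Definition closed_base B S := base_of B S /\ S `<=` closed.

End Bornology.

Definition C_born {R : realType} {X : topologicalType} (B : set_system X) :=
  initial_topology (id : continuousType X R -> {family B, X -> R}).

HB.instance Definition _ {R : realType} {X : topologicalType}
    (B : set_system X) :=
  Uniform.copy (@C_born R X B)
    (initial_topology (id : continuousType X R -> {family B, X -> R})).

Arguments C_born R X B : clear implicits.

(* The uniformity of [C_born R X B] has the sets [A; e] as a base; the library
   builds it from finite intersections of them. *)
Lemma C_born_entourageE (R : realType) (X : topologicalType)
    (B : set_system X) : [set: X] !=set0 -> bornology B ->
  @entourage (C_born R X B) =
  filter_from [set Ae : set X * R | B Ae.1 /\ 0 < Ae.2]
    (fun Ae => [set fg : C_born R X B * C_born R X B |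
      forall x, Ae.1 x -> `|fg.1 x - fg.2 x| < Ae.2]).
Proof.
move=> [x0 _] [_ Bcov BU _].
have [A0 BA0] : exists A, B A.
  by have [A BA _] : (\bigcup_(A in B) A) x0; [rewrite Bcov|exists A].
pose G := filter_from [set Ae : set X * R | B Ae.1 /\ 0 < Ae.2]
  (fun Ae => [set fg : (X -> R) * (X -> R) |
    forall x, Ae.1 x -> `|fg.1 x - fg.2 x| < Ae.2]).
have FG : Filter G.
  apply: filter_from_filter; first by exists (A0, 1).
  move=> [A e] [A' e'] /= [BA e0] [BA' e'0].
  exists (A `|` A', Num.min e e') => /=.
    by split; [exact: BU|rewrite lt_min e0].
  move=> fg h; split=> x Ax.
    by have /= := h x (or_introl Ax); rewrite lt_min => /andP[].
  by have /= := h x (or_intror Ax); rewrite lt_min => /andP[].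
apply/seteqP; split=> P /=.
  case=> V [W [D _ <-] WV] VP.
  have : G (\bigcap_(i in [set` D]) (projT1 i).2).
    apply: filter_bigI => -[[[A BA] E] /= /asboolP entE] _.
    move: entE; rewrite uniform_entourage => -[F].
    rewrite -entourage_ballE => -[e /= e0 eF] FE.
    exists (A, e) => //= fg h; apply: FE => x Ax; apply: eF.
    exact: h.
  case=> Ae BAe AeW; exists Ae => // -[f g] h.
  by apply: VP; apply: WV; apply: AeW.
case=> -[A e] /= [BA e0] AP.
pose V := [set fg : (X -> R) * (X -> R) |
    forall x, A x -> `|fg.1 x - fg.2 x| < e].
exists V; last by move=> [f g] /= h; exact: AP.
have entV : `[< @entourage {uniform` A -> R} V >].
  apply/asboolP; rewrite uniform_entourage.
  exists [set xy | ball xy.1 e xy.2]; first exact: entourage_ball (PosNum e0).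
  by move=> fg h x Ax; exact: h.
exists V => //.
have [i <-] : exists i : {p : {classic sigT B} *
    set ({uniform` A -> R} * {uniform` A -> R}) |
    `[< @entourage {uniform` projT1 p.1 -> R} p.2 >]}, (projT1 i).2 = V.
  by exists (exist _ (existT _ A BA, V) entV).
exact: finI_from1.
Qed.

Section Metrizability.
Context {R : realType} {T : topologicalType}.
Implicit Type d : T -> T -> R.

Definition is_metric d :=
  [/\ forall x y, 0 <= d x y,
      forall x y, d x y = 0 <-> x = y,
      forall x y, d x y = d y x &
      forall x y z, d x z <= d x y + d y z].

Definition metric_induces_topology d :=
  forall x : T, nbhs x =
    filter_from [set e : R | 0 < e] (fun e => [set y | d x y < e]).

Definition metric_cauchy d (u : nat -> T) :=
  forall e : R, 0 < e ->
    exists N, forall m n, (N <= m)%N -> (N <= n)%N -> d (u m) (u n) < e.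

Definition metric_cvg d (u : nat -> T) (l : T) :=
  forall e : R, 0 < e -> exists N, forall n, (N <= n)%N -> d (u n) l < e.

Definition metric_complete d :=
  forall u, metric_cauchy d u -> exists l, metric_cvg d u l.

End Metrizability.

Definition completely_metrizable (R : realType) (T : topologicalType) :=
  exists d : T -> T -> R,
    [/\ is_metric d, metric_induces_topology d & metric_complete d].

Section CompletenessProperties.
Context {T : topologicalType}.

Definition filterbase (F : set_system T) :=
  [/\ F !=set0, ~ F set0 &
      forall A B, F A -> F B -> exists2 C, F C & C `<=` A `&` B].

Definition controlled_by (F : set_system T) (U : nat -> set T) :=
  forall n, exists2 A, F A & A `<=` U n.

Definition complete_sequence (U : nat -> set T) :=
  forall F, filterbase F -> controlled_by F U ->
    (\bigcap_(A in F) closure A) !=set0.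

(* Sequences are indexed from 0 instead of 1. *)
Section Sieve.
Context {I : nat -> Type}.
Variables (U : forall n, I n -> set T) (p : forall n, I n.+1 -> I n).

Definition children_union n (i : I n) : set T :=
  \bigcup_(j in [set j | p j = i]) U j.

Definition sieve :=
  (forall n, \bigcup_i (@U n i) = [set: T]) /\
  (forall n (i : I n), U i = children_union i).

Definition almost_sieve :=
  (forall n, dense (\bigcup_i (@U n i))) /\
  (forall n (i : I n), children_union i `<=` U i /\
                       U i `<=` closure (children_union i)).

Definition open_family := forall n (i : I n), open (U i).

Definition pi_chain (c : forall n, I n) := forall n, p (c n.+1) = c n.

Definition complete_along_chains :=
  forall c, pi_chain c -> complete_sequence (fun n => U (c n)).

End Sieve.

Definition pi_base (P : set_system T) :=
  (forall U, P U -> open U /\ U !=set0) /\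
  (forall O, open O -> O !=set0 -> exists2 U, P U & U `<=` O).

Definition network (N : set_system T) :=
  forall (O : set T) x, open O -> O x -> exists A, [/\ N A, A x & A `<=` O].

Definition discrete_family (N : set_system T) :=
  forall x : T, exists2 W, nbhs x W &
    forall A B, N A -> N B -> A `&` W !=set0 -> B `&` W !=set0 -> A = B.

Definition q_point (D : set T) (x : T) :=
  exists U : nat -> set T, (forall n, open_nbhs x (U n)) /\
    forall u : nat -> T, (forall n, (U n `&` D) (u n)) ->
      cluster (u @ \oo) !=set0.

End CompletenessProperties.

Definition sieve_complete (T : topologicalType) :=
  exists (I : nat -> Type) (U : forall n, I n -> set T)
    (p : forall n, I n.+1 -> I n),
    [/\ sieve U p, open_family U & complete_along_chains U p].

Definition almost_complete (T : topologicalType) :=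
  exists (I : nat -> Type) (U : forall n, I n -> set T)
    (p : forall n, I n.+1 -> I n),
    [/\ almost_sieve U p, open_family U & complete_along_chains U p].

Definition pseudo_complete (T : topologicalType) :=
  exists P : nat -> set_system T, (forall n, pi_base (P n)) /\
    forall V : nat -> set T,
      (forall n, P n (V n) /\ closure (V n.+1) `<=` V n) ->
      (\bigcap_n V n) !=set0.

Definition sigma_space (T : topologicalType) :=
  exists N : nat -> set_system T,
    (forall n, discrete_family (N n)) /\ network (\bigcup_n N n).

(* Main.v *)
Require Import Defs.
From mathcomp Require Import all_boot all_order all_algebra.
From mathcomp Require Import lra.
From mathcomp Require Import all_classical all_reals all_analysis.

(* Each of (2)-(5) makes C(X) a Baire space with a q_D-point for some dense D:
   almost completeness by following a chain of the almost sieve, and a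
   pseudo-complete sigma-space because its sigma-discrete network is a
   neighbourhood base at the points of a dense G_delta set. A q_D-point forces
   [B] to have a countable base, and Baire category forces every point of [X] to
   have a neighbourhood in [B]; both arguments modify a continuous function at a
   point outside a closed member of [B]. Conversely, if [B] has a countable base
   [A n], then [sup_(n, x in A n) min (1 / (n + 1)) |f x - g x|] is a metric for
   the topology, and it is complete when every point has a neighbourhood in [B],
   since locally uniform limits are continuous. *)

Set Implicit Arguments.
Unset Strict Implicit.
Unset Printing Implicit Defensive.

Import Order.TTheory GRing.Theory Num.Theory.
Import numFieldNormedType.Exports.

Local Open Scope classical_set_scope.

(** * Completeness of regular spaces *)

Lemma decreasing_subset (T : Type) (U : nat -> set T) :
  (forall n, U n.+1 `<=` U n) -> forall m n, (m <= n)%N -> U n `<=` U m.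
Proof.
move=> dU m; elim=> [|n IH]; first by rewrite leqn0 => /eqP->.
by rewrite leq_eqVlt => /predU1P[-> //|/IH]; exact: subset_trans.
Qed.

Definition baire_space (T : topologicalType) :=
  forall G : nat -> set T, (forall n, open (G n)) -> (forall n, dense (G n)) ->
  (\bigcap_n G n) !=set0.

Section RegularSpaces.
Context {T : topologicalType}.
Hypothesis T_regular : regular_space T.

Lemma regular_shrink (O : set T) x : open O -> O x ->
  exists W, [/\ open W, W x & closure W `<=` O].
Proof.
move=> oO Ox; have [W Wx WO] := T_regular (open_nbhs_nbhs (conj oO Ox)).
exists W^°; split; [exact: open_interior|exact: Wx|].
exact: subset_trans (closureS (@interior_subset _ W)) WO.
Qed.

Lemma dense_shrink (G O : set T) : open G -> dense G -> open O -> O !=set0 ->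
  exists W, [/\ open W, W !=set0 & closure W `<=` O `&` G].
Proof.
move=> oG dG oO O0; have [x OGx] := dG O O0 oO.
have [W [oW Wx WOG]] := regular_shrink (openI oO oG) OGx.
by exists W; split => //; exists x.
Qed.

(** Members [V n] of the successive pi-bases are chosen with [closure (V n.+1)] inside both [V n]
    and [G n.+1]; pseudo-completeness then provides a point common to all [V n], hence to all
    [G n]. *)
Lemma pseudo_complete_baire : [set: T] !=set0 -> pseudo_complete T ->
  baire_space T.
Proof.
move=> T0 [P [Pb Pcap]] G oG dG.
(* The conditions on [nV.2] stand under the existential, so that choice yields a total function
   [step]. *)
have next (nV : nat * set T) : exists V', open nV.2 -> nV.2 !=set0 ->
    P nV.1 V' /\ closure V' `<=` nV.2 `&` G nV.1.
  case: nV => n V /=; have [[oV V0]|h] := pselect (open V /\ V !=set0).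
    have [W [oW W0 WV]] := dense_shrink (oG n) (dG n) oV V0.
    have [V' PV' V'W] := (Pb n).2 W oW W0.
    exists V' => _ _; split => //; exact: subset_trans (closureS V'W) WV.
  by exists V => oV V0; case: h.
have [step stepP] := choice next.
pose V := fix V n := step (n, if n is m.+1 then V m else setT).
have VP n : P n (V n) /\ closure (V n) `<=` G n.
  elim: n => [|n [/(Pb n).1[oV V0] _]].
    have [PV cV] := stepP (0, setT) openT T0.
    by split => // x /cV[].
  have [PV cV] := stepP (n.+1, V n) oV V0.
  by split => // x /cV[].
have [n|x Vx] := Pcap V.
  split; first by have [] := VP n.
  have [/(Pb n).1[oV V0] _] := VP n.
  by have [_ cV] := stepP (n.+1, V n) oV V0; move=> x /cV[].
exists x => n _; apply: (VP n).2; apply: subset_closure; exact: Vx.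
Qed.

(** Since [U] decreases, the tails of a sequence with [u n] in [U n] form a filterbase controlled by
    [U], and its cluster points are those of the sequence. *)
Lemma complete_sequence_q_point (U : nat -> set T) x :
  (forall n, open (U n)) -> (forall n, U n.+1 `<=` U n) ->
  complete_sequence U -> (\bigcap_n U n) x -> q_point setT x.
Proof.
move=> oU dU cU Ux; exists U; split=> [n|u uU].
  by split=> //; exact: Ux.
have dUn := decreasing_subset dU.
pose tail n := u @` [set k | (n <= k)%N].
have [||y yF] := cU (range tail).
- split; first by exists (tail 0%N), 0%N.
    move=> [n _ tn]; suff : tail n (u n) by rewrite /= tn.
    by exists n => /=.
  move=> _ _ [m _ <-] [n _ <-]; exists (tail (maxn m n)); first by exists (maxn m n).
  by move=> _ [k /= + <-]; rewrite geq_max => /andP[mk nk]; split; exists k.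
- move=> n; exists (tail n); first by exists n.
  move=> _ [k /= nk <-]; apply: (dUn _ _ nk); exact: (uU k).1.
exists y; rewrite clusterE => A [n _ nA].
apply: (closureS (_ : tail n `<=` A)); last by apply: yF; exists n.
by move=> _ [k /= nk <-]; exact: nA.
Qed.

(* A chain of the almost sieve is chosen together with open sets [V n] inside
   its members and with [closure (V n.+1) `<=` V n `&` G n]; completeness of the
   chain yields a point of [\bigcap_n V n]. *)
Lemma almost_complete_q_point (G : nat -> set T) : [set: T] !=set0 ->
  almost_complete T -> (forall n, open (G n)) -> (forall n, dense (G n)) ->
  exists2 x, (\bigcap_n G n) x & q_point setT x.
Proof.
move=> T0 [I [U [p [[Ucov Uch] oU cU]]]] oG dG.
pose good n (s : I n * set T) := [/\ open s.2, s.2 !=set0 & s.2 `<=` U n s.1].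
have next n (s : {s : I n * set T | good n s}) :
    {s' : {s : I n.+1 * set T | good n.+1 s} | p n (sval s').1 = (sval s).1 /\
      closure (sval s').2 `<=` (sval s).2 `&` G n}.
  apply: cid; case: s => -[i V] [/= oV [x Vx] VU].
  (* The children of [i] are dense in [U n i], so one of them meets the open set [V]. *)
  have [y [[j /= pj Uy] Vy]] := (Uch n i).2 _ (VU x Vx) V (open_nbhs_nbhs (conj oV Vx)).
  have oVU : open (V `&` U n.+1 j) by apply: openI => //; exact: oU.
  have [|W [oW W0 WV]] := dense_shrink (oG n) (dG n) oVU; first by exists y.
  have gW : good n.+1 (j, W).
    by split=> //= z Wz; have [[]] := WV z (subset_closure Wz).
  by exists (exist _ (j, W) gW); split=> //= z /WV[[]].
have [s0 _] : exists s : {s : I 0%N * set T | good 0%N s}, True.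
  have [x [_ [i _ Ux]]] := Ucov 0%N setT T0 openT.
  have gU : good 0%N (i, U 0%N i) by split; [exact: oU|exists x|].
  by exists (exist _ _ gU).
pose s := fix s n : {s : I n * set T | good n s} :=
  if n is m.+1 then sval (next m (s m)) else s0.
pose c n := (sval (s n)).1; pose V n := (sval (s n)).2.
have sS n : p n (c n.+1) = c n /\ closure (V n.+1) `<=` V n `&` G n.
  exact: svalP (next n (s n)).
have [oV V0 VU] : [/\ forall n, open (V n), forall n, V n !=set0 &
    forall n, V n `<=` U n (c n)].
  by split=> n; case: (svalP (s n)).
have dV n : V n.+1 `<=` V n by move=> x /subset_closure/(sS n).2[].
have dVn := decreasing_subset dV.
have cc : pi_chain p c by move=> n; exact: (sS n).1.
have [||x xV] := cU c cc (range V).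
- split; first by exists (V 0%N), 0%N.
    by move=> [n _ Vn]; have [x] := V0 n; rewrite Vn.
  move=> _ _ [m _ <-] [n _ <-]; exists (V (maxn m n)); first by exists (maxn m n).
  by rewrite subsetI; split; apply: dVn; rewrite (leq_maxl, leq_maxr).
- by move=> n; exists (V n); first by exists n.
(* The point [x] is only known to adhere to each [V n]; moving one index up puts it inside. *)
have xVG n : (V n `&` G n) x by apply: (sS n).2; apply: xV; exists n.+1.
exists x => [n _|]; first exact: (xVG n).2.
apply: (@complete_sequence_q_point (fun n => U n (c n))) => [n|n y Uy||n _].
- exact: oU.
- by apply: (Uch n (c n)).1; exists (c n.+1) => //; exact: cc.
- exact: cU.
- by apply: VU; exact: (xVG n).1.
Qed.

(* In the dense open set of points interior to the closure of every member of
   [N n] they adhere to, the network turns into a neighbourhood base. *)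
Lemma sigma_baire_q_point : baire_space T -> sigma_space T ->
  exists x : T, q_point setT x.
Proof.
move=> Tb [N [Nd Nn]].
pose G n := [set x | forall A, N n A -> closure A x -> (closure A)^° x].
(* An open set that meets [closure A] meets [A], so discreteness passes to the closures. *)
have GW n x : exists W, [/\ open W, W x & forall A C, N n A -> N n C ->
    closure A `&` W !=set0 -> closure C `&` W !=set0 -> A = C].
  have [W Wx WN] := Nd n x; exists W^°; split => [||A C NA NC].
  - exact: open_interior.
  - exact: Wx.
  move=> [y [Ay Wy]] [z [Cz Wz]]; apply: WN => //.
    exact: Ay _ Wy.
  exact: Cz _ Wz.
have inG n x A W : open W -> N n A -> W x -> (closure A)^° x \/ ~ closure A x ->
    (forall A C, N n A -> N n C ->
    closure A `&` W !=set0 -> closure C `&` W !=set0 -> A = C) ->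
    closure A `&` W !=set0 -> G n x.
  move=> oW NA Wx AVnA WN AW C NC Cx.
  have -> : C = A by apply: WN => //; exists x.
  by case: AVnA => // nA; case: nA; rewrite (_ : A = C) //; apply: WN => //; exists x.
have oG n : open (G n).
  rewrite openE => x Gx; have [W [oW Wx WN]] := GW n x.
  have [[A [NA AW]]|noA] := pselect (exists A, N n A /\ closure A `&` W !=set0); last first.
    apply: (filterS _ (open_nbhs_nbhs (conj oW Wx))) => y Wy A NA Ay.
    by exfalso; apply: noA; exists A; split=> //; exists y.
  have [Ax|nAx] := pselect (closure A x).
    have oWA : open (W `&` (closure A)^°) by apply: openI => //; exact: open_interior.
    apply: (filterS _ (open_nbhs_nbhs (conj oWA (conj Wx (Gx A NA Ax))))).
    by move=> y [Wy Ay]; apply: inG WN AW => //; left.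
  have oWA : open (W `&` ~` closure A).
    by apply: openI => //; apply: closed_openC; exact: closed_closure.
  apply: (filterS _ (open_nbhs_nbhs (conj oWA (conj Wx nAx)))).
  by move=> y [Wy Ay]; apply: inG WN AW => //; right.
have dG n : dense (G n).
  move=> O [x Ox] oO; have [Gx|/existsNP[A]] := pselect (G n x); first by exists x.
  move=> /not_implyP[NA] /not_implyP[Ax nAx].
  have [W [oW Wx WN]] := GW n x.
  (* As [x] is not interior to [closure A], points outside [closure A] occur arbitrarily near [x];
     those in [W] belong to [G n]. *)
  have [y [Oy Wy nAy]] : exists y, [/\ O y, W y & ~ closure A y].
    apply: contrapT => /forallNP h; apply: nAx.
    apply: (filterS _ (open_nbhs_nbhs (conj (openI oO oW) (conj Ox Wx)))).
    by move=> y [Oy Wy]; apply: contrapT => nAy; apply: (h y).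
  by exists y; split=> //; apply: (inG n y A W) => //; [right|exists x].
have [x Gx] := Tb G oG dG; exists x.
pose P n A := [/\ open A, A x & forall C, N n C -> C x -> A `<=` closure C].
(* At most one member of [N n] contains [x]: the interior of its closure is taken, or the whole
   space if there is none. *)
have [U UP] : {U : nat -> set T & forall n, P n (U n)}.
  apply: choice => n.
  have [[C [NC Cx]]|noC] := pselect (exists C, N n C /\ C x).
    exists (closure C)^°; split; first exact: open_interior.
      by apply: (Gx n I) => //; exact: subset_closure.
    move=> C' NC' C'x; suff -> : C' = C by exact: interior_subset.
    have [W [oW Wx WN]] := GW n x.
    by apply: WN => //; exists x; split=> //; exact: subset_closure.
  exists setT; split => // [|C NC Cx]; first exact: openT.
  by exfalso; apply: noC; exists C.
pose V := fix V n := if n is m.+1 then V m `&` U n else U 0%N.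
have VP n : open (V n) /\ V n x.
  elim: n => [|n [oV Vx]]; first by have [] := UP 0%N.
  by have [oU Ux _] := UP n.+1; split=> //; exact: openI.
have VU n : V n `<=` U n by case: n => [//|n] y [].
have /decreasing_subset dV : forall n, V n.+1 `<=` V n by move=> n y [].
exists V; split=> [n|u uV]; first exact: VP.
exists x => A C [n _ nA] Cx.
have [Q [oQ Qx] QC] : exists2 Q, open_nbhs x Q & Q `<=` C by move: Cx; rewrite nbhsE.
(* For a network member [D] of [N m] with [x] in [D] and [D] inside [W], the sets [V k] with
   [k >= m] lie in [closure D], hence in [Q]: the sequence [u] even converges to [x]. *)
have [W [oW Wx WQ]] := regular_shrink oQ Qx.
have [D [[m _ ND] Dx DW]] := Nn W x oW Wx.
exists (u (maxn n m)); split; first by apply: nA => /=; exact: leq_maxl.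
apply/QC/WQ/(closureS DW); have [_ _ /(_ D ND Dx)] := UP m; apply.
apply: VU; apply: (dV m (maxn n m)); first by rewrite leq_maxr.
exact: (uV _).1.
Qed.

End RegularSpaces.

Local Open Scope ring_scope.

(** * Complete metrics *)

Lemma exists_invS_lt (R : realType) (e : R) : 0 < e -> exists n, n.+1%:R^-1 < e.
Proof.
move=> e0; have [N _ /(_ N (leqnn N))] := near_infty_natSinv_lt (PosNum e0).
by exists N.
Qed.

Lemma lef_invS (R : realType) m n : (m <= n)%N -> n.+1%:R^-1 <= m.+1%:R^-1 :> R.
Proof. by move=> mn; rewrite lef_pV2 ?posrE ?ltr0Sn// ler_nat. Qed.

Section CompleteMetric.
Context {R : realType} {T : topologicalType}.
Variable d : T -> T -> R.
Hypotheses (d_metric : is_metric d) (d_top : metric_induces_topology d).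
Local Notation dball x e := [set y | d x y < e].

Let d_ge0 x y : 0 <= d x y. Proof. by have [] := d_metric. Qed.
Let dxx x : d x x = 0.
Proof. by have [_ /(_ x x)[_ h] _ _] := d_metric; exact: h. Qed.
Let d_sym x y : d x y = d y x. Proof. by have [] := d_metric. Qed.
Let d_triangle x y z : d x z <= d x y + d y z.
Proof. by have [] := d_metric. Qed.

Let nbhs_dball x (e : R) : 0 < e -> nbhs x (dball x e).
Proof. by move=> e0; rewrite d_top; exists e. Qed.

Let open_dball x (e : R) : open (dball x e).
Proof.
rewrite openE => y /= xy; rewrite /interior/= d_top.
exists (e - d x y) => [|z] /=; first by rewrite subr_gt0.
by rewrite ltrBrDl => /(le_lt_trans (d_triangle x y z)).
Qed.

Let dball_center x (e : R) : 0 < e -> dball x e x.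
Proof. by rewrite /= dxx. Qed.

Let closure_dball (A : set T) x :
  closure A x <-> forall e : R, 0 < e -> exists2 y, A y & d x y < e.
Proof.
split=> [Ax e e0|h P]; first by have [y [Ay xy]] := Ax _ (nbhs_dball x e0); exists y.
by rewrite d_top => -[e e0 eP]; have [y Ay xy] := h e e0; exists y; split=> //; exact: eP.
Qed.

(** The diameters of the [U n] tend to 0, so [y] is Cauchy and [l] is its limit. The [U n] need not
    be closed, so the conclusion says that they shrink to [l], not that they contain it. *)
Let cantor (U : nat -> set T) (y : nat -> T) : metric_complete d ->
  (forall n, U n.+1 `<=` U n) -> (forall n, U n (y n)) ->
  (forall n, exists x, U n.+1 `<=` dball x n.+1%:R^-1) ->
  exists l, forall e : R, 0 < e -> exists n, U n `<=` dball l e.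
Proof.
move=> dc dU Uy Ud.
have diam (e : R) : 0 < e -> exists n, forall a b, U n a -> U n b -> d a b < e.
  move=> e0; have [n ne] := exists_invS_lt (divr_gt0 e0 (@ltr0n R 2)).
  have [x Ux] := Ud n; exists n.+1 => a b /Ux /= xa /Ux /= xb.
  have := d_triangle a x b; rewrite (d_sym a x).
  by move: ne xa xb; move: n.+1%:R^-1 => r; lra.
have dUn := decreasing_subset dU.
have [e e0|l yl] := dc y.
  have [N UN] := diam e e0; exists N => m n Nm Nn.
  by apply: UN; [exact: dUn Nm _ (Uy m)|exact: dUn Nn _ (Uy n)].
exists l => e e0; have e20 : 0 < e / 2 by lra.
have [N UN] := diam _ e20; have [M yM] := yl _ e20.
exists N => z /= Nz; have := yM _ (leq_maxr N M).
have := UN _ _ (dUn _ _ (leq_maxl N M) _ (Uy _)) Nz.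
set w := y _; have := d_triangle l w z; rewrite (d_sym l w); lra.
Qed.

(** An index of level [n] is a list of [n] centres, for balls of radii 1, 1/2, ..., 1/n; the parent
    of an index forgets the last centre. *)
Fixpoint ball_chain (n : nat) : Type :=
  if n is m.+1 then (ball_chain m * T)%type else unit.

Fixpoint ball_chain_set n : ball_chain n -> set T :=
  if n is m.+1 then fun c => ball_chain_set c.1 `&` dball c.2 m.+1%:R^-1
  else fun=> setT.

Lemma complete_metric_sieve_complete : metric_complete d -> sieve_complete T.
Proof.
move=> dc; exists ball_chain, ball_chain_set, (fun n c => c.1); split.
- have ch n (i : ball_chain n) :
      ball_chain_set i = children_union ball_chain_set (fun n c => c.1) i.
    apply/seteqP; split=> [x ix|x [[j y] /= -> []//]].
    by exists (i, x) => //=; split=> //; apply: dball_center; rewrite invr_gt0.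
  split=> // n; apply/seteqP; split=> // x _.
  elim: n => [|n [i _ ix]]; first by exists tt.
  by move: ix; rewrite ch => -[j _ jx]; exists j.
- elim=> [|n IH] i /=; first exact: openT.
  by apply: openI; [exact: IH|exact: open_dball].
move=> c cc F [[A0 FA0] F0 FI] FU.
have Fpt A : F A -> exists x, A x.
  move=> FA; apply/set0P; apply/eqP => A0'; apply: F0; by rewrite -A0'.
have Uc n : ball_chain_set (c n.+1) =
    ball_chain_set (c n) `&` dball (c n.+1).2 n.+1%:R^-1 by rewrite /= cc.
have /choice[y yU] n : exists y, ball_chain_set (c n) y.
  by have [A /Fpt[x Ax] AU] := FU n; exists x; exact: AU.
have [|n|l ll] := @cantor (fun n => ball_chain_set (c n)) y dc _ yU.
- by move=> n; rewrite Uc => x [].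
- by exists (c n.+1).2; rewrite Uc => x [].
exists l => A FA; apply/closure_dball => e e0.
(* A member of [F] inside a small [U n] lies in the [e]-ball of [l], and it meets [A] because [F] is
   a filterbase. *)
have [n nl] := ll e e0; have [C FC CU] := FU n.
have [D FD DAC] := FI A C FA FC; have [x /DAC[Ax Cx]] := Fpt D FD.
by exists x => //; exact/nl/CU.
Qed.

Lemma complete_metric_pseudo_complete : metric_complete d -> pseudo_complete T.
Proof.
move=> dc; exists (fun n => [set V | [/\ open V, V !=set0 &
  exists x, V `<=` dball x n.+1%:R^-1]]); split=> [n|V VP].
  split=> [U [oU U0 _] //|O oO [x Ox]].
  have n0 : 0 < n.+1%:R^-1 :> R by rewrite invr_gt0.
  exists (O `&` dball x n.+1%:R^-1); last exact: subIsetl.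
  split; [|by exists x; split=> //; exact: dball_center|].
    by apply: openI => //; exact: open_dball.
  by exists x; exact: subIsetr.
have dV n : V n.+1 `<=` V n.
  by move=> x Vx; apply: (VP n).2; exact: subset_closure.
have /choice[y yV] n : exists y, V n y by have [[]] := VP n.
have [|l ll] := cantor dc dV yV.
  move=> n; have [[_ _ [x Vx]] _] := VP n; exists x.
  exact: subset_trans (dV n) Vx.
(* It suffices that [l] adheres to [V n.+1], whose closure lies in [V n]. *)
exists l => n _; apply: (VP n).2; apply/closure_dball => e e0.
have [m ml] := ll e e0; exists (y (maxn n.+1 m)).
  exact: decreasing_subset dV _ _ (leq_maxl _ _) _ (yV _).
by apply: ml; exact: decreasing_subset dV _ _ (leq_maxr _ _) _ (yV _).
Qed.

(** This orders the centres in Stone's construction. Reflexivity and antisymmetry of the well-order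
    come from least elements of singletons and pairs, after which it is made strict. *)
Lemma well_order_min : exists lt : T -> T -> Prop,
  (forall x y, [\/ lt x y, x = y | lt y x]) /\
  (forall A : set T, A !=set0 -> exists2 x, A x & forall z, lt z x -> ~ A z).
Proof.
have [r wo] := wochoice.well_ordering_principle T.
have wmin (A : set T) : A !=set0 ->
    exists2 z, A z & (forall y, A y -> r z y) /\
      forall w, A w -> (forall y, A y -> r w y) -> w = z.
  move=> [x Ax]; have [|z [[zA zl] zu]] := wo (mem A); first by exists x; rewrite inE.
  exists z; first by move: zA; rewrite inE.
  split=> [y Ay|w Aw wl]; first by apply: zl; rewrite inE.
  by apply/esym/zu; split; [rewrite inE|move=> y; rewrite inE; exact: wl].
have rr x : r x x by have [|_ -> [+ _]] := wmin [set x]; [exists x|exact].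
have ra x y : r x y -> r y x -> x = y.
  move=> xy yx; have [|z _ [_ zu]] := wmin [set x; y]; first by exists x; left.
  have -> : x = z by apply: zu; [left|move=> _ [->|->]].
  by apply/esym/zu; [right|move=> _ [->|->]].
exists (fun x y => r x y /\ x <> y); split=> [x y|A A0].
  have [->|xy] := pselect (x = y); first by constructor 2.
  have [|z Az [zl _]] := wmin [set x; y]; first by exists x; left.
  have rx := zl x (or_introl erefl); have ry := zl y (or_intror erefl).
  by case: Az rx ry => -> *; [constructor 1|constructor 3; split=> // /esym].
have [x Ax [xl _]] := wmin A A0; exists x => // z [zx nzx] Az.
by apply: nzx; apply: ra => //; exact: xl.
Qed.

(* Stone's construction: for a fixed radius, the points that are deep inside the
   ball of [x] and in no ball of a predecessor of [x] form a family, indexed by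
   [x], of uniformly separated sets. *)
Lemma metric_sigma_space : sigma_space T.
Proof.
have [lt [ltP lt_min]] := well_order_min.
pose E n k x := [set y | d x y + k.+1%:R^-1 <= n.+1%:R^-1 /\
  forall z, lt z x -> n.+1%:R^-1 <= d z y].
have Esep n k x x' y y' : lt x x' -> E n k x y -> E n k x' y' ->
    k.+1%:R^-1 <= d y y'.
  move=> xx' [xy _] [_ /(_ x xx') xy'].
  by have := d_triangle x y y'; move: n.+1%:R^-1 k.+1%:R^-1 xy xy' => r r'; lra.
exists (fun m => [set A | exists n k x, m = pickle (n, k) /\ A = E n k x]).
split=> [m w|O y oO Oy].
  have [[[n k] mE]|nm] := pselect (exists nk : nat * nat, m = pickle nk); last first.
    exists setT; first exact: filterT.
    by move=> A C [n [k [x [mE _]]]]; exfalso; apply: nm; exists (n, k).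
  (* With half the separation as radius, the ball cannot meet two members with different centres. *)
  exists (dball w (k.+1%:R^-1 / 2)).
    by apply: nbhs_dball; rewrite divr_gt0// invr_gt0.
  move=> _ _ [n1 [k1 [x [m1 ->]]]] [n2 [k2 [x' [m2 ->]]]].
  have [-> ->] : (n1, k1) = (n, k) by apply: (pcan_inj pickleK); rewrite -m1.
  have [-> ->] : (n2, k2) = (n, k) by apply: (pcan_inj pickleK); rewrite -m2.
  move=> [y [Ey /= wy]] [y' [Ey' /= wy']].
  have := d_triangle y w y'; rewrite (d_sym y w) => yy'.
  case: (ltP x x') => [xx'|->//|xx']; exfalso.
    have := Esep _ _ _ _ _ _ xx' Ey Ey'.
    by move: k.+1%:R^-1 wy wy' => r; lra.
  have := Esep _ _ _ _ _ _ xx' Ey' Ey; rewrite (d_sym y').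
  by move: k.+1%:R^-1 wy wy' => r; lra.
have [e /= e0 eO] : filter_from [set e : R | 0 < e] (fun e => dball y e) O.
  by rewrite -d_top; exact: open_nbhs_nbhs.
have [n ne] := exists_invS_lt (divr_gt0 e0 (@ltr0n R 2)).
have n0 : 0 < n.+1%:R^-1 :> R by rewrite invr_gt0.
(* Taking the first [x] whose ball contains [y] keeps [y] out of all earlier balls; [k] then
   measures how deep [y] lies in the ball of [x]. *)
have [|x /= xy xmin] := lt_min [set x | d x y < n.+1%:R^-1].
  by exists y; exact: dball_center.
have xy0 : 0 < n.+1%:R^-1 - d x y by rewrite subr_gt0.
have [k kxy] := exists_invS_lt xy0.
exists (E n k x); split; first by exists (pickle (n, k)) => //; exists n, k, x.
  split=> [|z /xmin /negP]; last by rewrite -leNgt.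
  by rewrite -lerBrDl ltW.
move=> z [xz _]; apply: eO => /=.
have k0 : 0 < k.+1%:R^-1 :> R by rewrite invr_gt0.
have := d_triangle y x z; rewrite (d_sym y x).
by move: n.+1%:R^-1 k.+1%:R^-1 ne xy xz k0 => r r'; lra.
Qed.

End CompleteMetric.

(** * Uniform convergence on a bornology *)

Lemma real_cauchy_cvg (R : realType) (u : nat -> R) :
  (forall e : R, 0 < e -> exists N, forall m n, (N <= m)%N -> (N <= n)%N ->
    `|u m - u n| < e) ->
  exists l, forall e : R, 0 < e -> exists N, forall n, (N <= n)%N ->
    `|u n - l| < e.
Proof.
move=> uC; have /cvg_ex[l ul] : cvg (u @ \oo).
  apply: cauchy_cvg; apply/cauchy_ballP => e e0.
  have [N uN] := uC e e0; pose t := u @` [set n | (N <= n)%N].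
  exists (t, t); first by split; exists N => // n Nn; exists n.
  by move=> _ [[m /= Nm <-] [n /= Nn <-]]; exact: uN.
exists l => e e0; have [N _ Nl] := (cvgrPdist_lt _ _).1 ul e e0.
by exists N => n Nn; rewrite distrC; exact: Nl.
Qed.

Section BornologicalConvergence.
Context {R : realType} {X : metricType R} {B S : set_system X}.
Hypotheses (X_nonempty : [set: X] !=set0) (B_bornology : bornology B)
  (S_closed_base : closed_base B S).
Local Notation CX := (C_born R X B).
Implicit Types (f g h : CX) (A E : set X).

Let B_subset A E : B A -> E `<=` A -> E !=set0 -> B E.
Proof. by have [_ _ _] := B_bornology; exact. Qed.

Let B_setU A E : B A -> B E -> B (A `|` E).
Proof. by have [_ _ BU _] := B_bornology; exact: BU. Qed.

Let B_set1 x : B [set x].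
Proof.
have [_ Bcov _ _] := B_bornology.
have [A BA Ax] : (\bigcup_(A in B) A) x by rewrite Bcov.
by apply: B_subset BA _ _ => [y -> //|]; exists x.
Qed.

Let SB A : S A -> B A. Proof. by have [[+ _] _] := S_closed_base; exact. Qed.

Let S_closed A : S A -> closed A.
Proof. by have [_] := S_closed_base; exact. Qed.

Let B_subS E : B E -> exists2 A, S A & E `<=` A.
Proof. by have [[_] + _] := S_closed_base; exact. Qed.

Lemma C_born_nbhsP f (P : set CX) : nbhs f P <->
  exists A (e : R), [/\ B A, 0 < e &
    forall g, (forall x, A x -> `|f x - g x| < e) -> P g].
Proof.
rewrite nbhsP /nbhs_ /= C_born_entourageE//; split.
  move=> [V [[A e] /= [BA e0] Ae] fP]; exists A, e; split=> // g fg.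
  by apply/fP/xsectionP; exact: Ae.
move=> [A [e [BA e0 AeP]]].
exists [set fg : CX * CX | forall x, A x -> `|fg.1 x - fg.2 x| < e].
  by exists (A, e).
by move=> g /xsectionP; exact: AeP.
Qed.

(** Complete regularity gives a continuous [h] equal to 1 on [A] and 0 at [y]; the function is
    [h * (f - c) + c]. *)
Lemma C_born_modify f A y (c : R) : closed A -> ~ A y ->
  exists g : CX, (forall x, A x -> g x = f x) /\ g y = c.
Proof.
move=> clA nAy.
have /(@uniform_separatorP _ R)[h [hc _ hy hA]] :=
  @uniform_completely_regular R X y A clA nAy.
have gc : continuous (fun x => h x * (f x - c) + c).
  move=> x; apply: cvgD; last exact: cvg_cst.
  apply: cvgM; first exact: hc.
  by apply: cvgB; [exact: (@cts_fun _ _ f)|exact: cvg_cst].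
exists (mkcts gc : continuousType X R); split=> [x Ax|] /=; rewrite /mkcts.
  by rewrite (hA (h x)) ?mul1r ?subrK//; exists x.
by rewrite (hy (h y)) ?mul0r ?add0r//; exists y.
Qed.

(* If [E] is contained in no [A n], pick [x n] in [E] outside [A n] and [g n] in
   [U n] and in [D] with [g n (x n) > g m (x n) + 2] for [m < n]; no two of the
   [g n] then lie in the same ball [E; 1], so that they do not cluster. *)
Lemma q_point_countable_base (D : set CX) f : dense D -> q_point D f ->
  exists A : nat -> set X, (forall n, B (A n)) /\
    forall E, B E -> exists n, E `<=` A n.
Proof.
move=> dD [U [fU Ucl]].
have /choice[Ae AeP] n : exists Ae : set X * R, [/\ S Ae.1, 0 < Ae.2 &
    forall g, (forall x, Ae.1 x -> `|f x - g x| < Ae.2) -> U n g].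
  have /C_born_nbhsP[A [e [BA e0 AU]]] := open_nbhs_nbhs (fU n).
  have [A' SA' AA'] := B_subS BA; exists (A', e); split=> // g fg.
  by apply: AU => x /AA'; exact: fg.
exists (fun n => (Ae n).1); split=> [n|E BE]; first by have [/SB] := AeP n.
apply: contrapT => /forallNP nE.
have /choice[x xP] n : exists x, E x /\ ~ (Ae n).1 x.
  by have /existsNP[x /not_implyP[Ex nAx]] := nE n; exists x.
have /choice[step stepP] (nb : nat * (X -> R)) : exists g,
    (U nb.1 `&` D) g /\ nb.2 (x nb.1) + 2 < g (x nb.1).
  case: nb => n b /=; set y := x n.
  have [SA e0 AU] := AeP n; have [Ey nAy] := xP n.
  (* The 3 leaves a margin of 1 for replacing [h] by a nearby element of [D], with value still above
     [b y + 2]. *)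
  have [h [hA hy]] := C_born_modify f (b y + 3) (S_closed SA) nAy.
  have : nbhs h [set g | U n g /\ b y + 2 < g y].
    apply/C_born_nbhsP; exists ((Ae n).1 `|` [set y]), (Num.min (Ae n).2 1).
    split; [by apply: B_setU => //; exact: SB|by rewrite lt_min e0 ltr01|].
    move=> g hg; split.
      apply: AU => z Az; rewrite -hA//.
      by have := hg z (or_introl Az); rewrite lt_min => /andP[].
    have := hg y (or_intror erefl); rewrite lt_min => /andP[_].
    by rewrite hy ltr_norml => /andP[]; lra.
  rewrite nbhsE => -[V [oV Vh] VU].
  have [|g [Vg Dg]] := dD V _ oV; first by exists h.
  by have [Ug gy] := VU g Vg; exists g.
(* [b n] is the pointwise maximum of 0 and the functions chosen before stage [n]. *)
pose b := fix b n := if n is m.+1 then fun z => Num.max (b m z) (step (m, b m) z)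
  else fun=> 0.
pose g n := step (n, b n).
have gb m n z : (m < n)%N -> g m z <= b n z.
  elim: n => [//|n IH]; rewrite ltnS leq_eqVlt => /predU1P[->|/IH mn] /=.
    by rewrite le_max lexx orbT.
  by rewrite le_max mn.
have [n|h hg] := Ucl g; first by have [] := stepP (n, b n).
have hE : nbhs h [set k | forall z, E z -> `|h z - k z| < 1].
  by apply/C_born_nbhsP; exists E, 1; split=> //.
have tl m : nbhs (g @ \oo) [set g n | n in [set n | (m <= n)%N]].
  by exists m => // n mn; exists n.
(* A cluster point [h] would have some [g m] and a later [g n] both within 1 of it on [E], although
   they differ by more than 2 at [x n]. *)
have [_ [[m _ <-] hm]] := hg _ _ (tl 0%N) hE.
have [_ [[n /= mn <-] hn]] := hg _ _ (tl m.+1) hE.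
have [Ex _] := xP n; have := hm _ Ex; have := hn _ Ex.
have [_] := stepP (n, b n); rewrite -/(g n) /= => gx.
have := gb _ _ (x n) mn.
by rewrite !ltr_norml => ? /andP[? ?] /andP[? ?]; lra.
Qed.

(* Otherwise the functions exceeding [n] somewhere in the ball of radius
   [1 / (n + 1)] around [x] form a dense open set, for every [n]. *)
Lemma baire_locally_bounded (x : X) : baire_space CX -> exists2 E, B E & nbhs x E.
Proof.
move=> CX_baire; apply: contrapT => nE.
have noB A (e : R) : B A -> 0 < e -> exists2 y, ball x e y & ~ A y.
  move=> BA e0; apply: contrapT => h; apply: nE; exists A => //.
  apply: (filterS _ (nbhsx_ballx x e e0)) => y xy.
  by apply: contrapT => nAy; apply: h; exists y.
pose G n := [set f : CX | exists2 y, ball x n.+1%:R^-1 y & n%:R < f y].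
have [n|n O [f Of] oO|f fG] := CX_baire G.
- rewrite openE => f [y xy fy]; apply/C_born_nbhsP.
  exists [set y], (f y - n%:R); split=> //; first by rewrite subr_gt0.
  move=> g fg; exists y => //; have := fg y erefl.
  by rewrite ltr_norml => /andP[_]; lra.
- have /C_born_nbhsP[A [e [BA e0 AO]]] := open_nbhs_nbhs (conj oO Of).
  have [A' SA' AA'] := B_subS BA.
  have n0 : 0 < n.+1%:R^-1 :> R by rewrite invr_gt0.
  have [y xy nAy] := noB A' _ (SB SA') n0.
  have [g [gA gy]] := C_born_modify f n.+1%:R (S_closed SA') nAy.
  exists g; split; last by exists y => //; rewrite gy ltr_nat.
  by apply: AO => z /AA' Az; rewrite gA// subrr normr0.
have := @cts_fun _ _ f x => /cvgrPdist_lt/(_ 1 ltr01).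
rewrite -nbhs_ballE => -[e /= e0 xe].
have [n ne] := exists_invS_lt e0.
(* This [m] makes the ball of radius [1 / (m + 1)] small enough for [f < f x + 1] to hold there,
   while [m > f x + 1], against [f] being in [G m]. *)
set m := maxn n (Num.truncn (f x + 1)).+1.
have [y xy my] := fG m Logic.I.
have fy : f y < f x + 1.
  have /xe : ball x e y.
    by apply: le_ball xy; apply: le_trans (ltW ne); apply: lef_invS; exact: leq_maxl.
  by rewrite /= ltr_norml => /andP[]; lra.
have : f x + 1 < m%:R.
  apply: lt_le_trans (truncnS_gt _) _; rewrite ler_nat; exact: leq_maxr.
by lra.
Qed.

(** * The metric given by a countable base of the bornology *)

Section BornologicalMetric.
Variable A : nat -> set X.
Hypothesis BA : forall n, B (A n).
Hypothesis A_base : forall E, B E -> exists n, E `<=` A n.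

(** The cap [1 / (n + 1)] keeps the supremum finite and makes all but finitely many [A n] irrelevant
    at a given scale. *)
Let dist_set f g := [set r : R | exists n x,
  A n x /\ r = Num.min n.+1%:R^-1 `|f x - g x|].

Definition born_dist f g : R := sup (dist_set f g).

Let dist_le f g (e : R) : born_dist f g <= e <->
  forall n x, A n x -> Num.min n.+1%:R^-1 `|f x - g x| <= e.
Proof.
split=> [fge n x Ax|h].
  apply: le_trans fge; apply: ub_le_sup; last by exists n, x.
  exists 1 => _ [k [z [_ ->]]]; rewrite ge_min; apply/orP; left.
  by rewrite invf_le1// ler1n.
apply: ge_sup => [|_ [n [x [Ax ->]]]]; last exact: h.
have [Bne _ _ _] := B_bornology; have [x Ax] := Bne _ (BA 0%N).
by exists (Num.min 0%N.+1%:R^-1 `|f x - g x|), 0%N, x.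
Qed.

Let dist_ge f g n x : A n x -> Num.min n.+1%:R^-1 `|f x - g x| <= born_dist f g.
Proof. by move=> Ax; exact: (dist_le f g _).1. Qed.

(** If [E] lies in [A n], a distance below [1 / (n + 1)] means that the cap is not attained on [E],
    so it bounds the true difference. *)
Let pointwise_small E (e : R) : B E -> 0 < e -> exists2 r : R, 0 < r &
  forall f g, born_dist f g < r -> forall x, E x -> `|f x - g x| < e.
Proof.
move=> BE e0; have [n En] := A_base BE; exists (Num.min n.+1%:R^-1 e).
  by rewrite lt_min e0 invr_gt0 ltr0n.
move=> f1 g1; rewrite lt_min => /andP[dn de] x /En Ax.
have := le_lt_trans (dist_ge f1 g1 Ax) de.
have := le_lt_trans (dist_ge f1 g1 Ax) dn.
by rewrite !gt_min ltxx /= => fgn /orP[/(lt_trans fgn)|].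
Qed.

(** Only the [A n] with [n <= N] matter, the later caps being below [e]; their finite union lies in
    [B]. *)
Let dist_small (e : R) : 0 < e -> exists2 E, B E &
  forall f g, (forall x, E x -> `|f x - g x| < e) -> born_dist f g <= e.
Proof.
move=> e0; have [N Ne] := exists_invS_lt e0.
have [E BE AE] : exists2 E, B E & forall n, (n <= N)%N -> A n `<=` E.
  elim: N {Ne} => [|N [E BE AE]]; first by exists (A 0%N) => // n; rewrite leqn0 => /eqP->.
  exists (E `|` A N.+1) => [|n]; first exact: B_setU.
  rewrite leq_eqVlt => /predU1P[->|/AE AnE]; first exact: subsetUr.
  by apply: subset_trans AnE _; exact: subsetUl.
exists E => // f g fg; apply/dist_le => n x Anx; rewrite ge_min.
have [nN|Nn] := leqP n N; first by rewrite (ltW (fg x _)) ?orbT//; exact: AE Anx.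
by rewrite (le_trans (lef_invS R (ltnW Nn)) (ltW Ne)).
Qed.

Lemma born_dist_metric : is_metric born_dist.
Proof.
have A_cover x : exists n, A n x.
  by have [n nx] := A_base (B_set1 x); exists n; exact: nx.
have d0 f g : 0 <= born_dist f g.
  have [x _] := X_nonempty; have [n Ax] := A_cover x.
  by apply: le_trans (dist_ge f g Ax); rewrite le_min invr_ge0 ler0n normr_ge0.
split=> // [f g|f g|f g h].
- split=> [fg0|->]; last first.
    apply: le_anti; rewrite d0 andbT; apply/dist_le => n x _.
    by rewrite subrr normr0 ge_min lexx orbT.
  apply/continuousEP => x; have [n Ax] := A_cover x.
  have := dist_ge f g Ax; rewrite fg0 ge_min => /orP[|].
    by rewrite leNgt invr_gt0 ltr0n.
  by rewrite normr_le0 subr_eq0 => /eqP.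
- by apply: le_anti; apply/andP; split; apply/dist_le => n x Ax;
    rewrite distrC; exact: dist_ge.
apply/dist_le => n x Ax; have := dist_ge f g Ax; have := dist_ge g h Ax.
have := ler_distD (g x) (f x) (h x); have := normr_ge0 (f x - g x).
have := normr_ge0 (g x - h x); have n0 : 0 <= n.+1%:R^-1 :> R by rewrite invr_ge0.
have := d0 f g; have := d0 g h.
(* Capping at [r >= 0] preserves the triangle inequality, case by case. *)
by move: n.+1%:R^-1 n0 => r r0; case: (leP r `|f x - h x|) => ?;
  case: (leP r `|f x - g x|) => ?; case: (leP r `|g x - h x|) => ?; lra.
Qed.

Lemma born_dist_topology : metric_induces_topology born_dist.
Proof.
move=> f; apply/seteqP; split=> P.
  move=> /C_born_nbhsP[E [e [BE e0 EP]]].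
  have [r r0 rE] := pointwise_small BE e0.
  by exists r => // g fg; apply: EP; exact: rE.
move=> [e /= e0 eP]; have e20 : 0 < e / 2 by lra.
have [E BE Ee] := dist_small e20.
apply/C_born_nbhsP; exists E, (e / 2); split=> // g /Ee fg.
by apply: eP => /=; lra.
Qed.

(** A Cauchy sequence is uniformly Cauchy on each member of [B], so its pointwise limit is uniform
    there; neighbourhoods belonging to [B] make this limit continuous. *)
Lemma born_dist_complete : (forall x : X, exists2 E, B E & nbhs x E) ->
  metric_complete born_dist.
Proof.
move=> B_local u uC.
have uE E (e : R) : B E -> 0 < e -> exists N, forall m n, (N <= m)%N -> (N <= n)%N ->
    forall x, E x -> `|u m x - u n x| < e.
  move=> BE e0; have [r r0 rE] := pointwise_small BE e0.
  have [N uN] := uC r r0; exists N => m n Nm Nn.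
  by apply: rE; exact: uN.
have /choice[l ul] (x : X) : exists l, forall e : R, 0 < e ->
    exists N, forall n, (N <= n)%N -> `|u n x - l| < e.
  apply: real_cauchy_cvg => e e0; have [N uN] := uE _ e (B_set1 x) e0.
  by exists N => m n Nm Nn; exact: uN.
have ulE E (e : R) : B E -> 0 < e -> exists N, forall n, (N <= n)%N ->
    forall x, E x -> `|u n x - l x| < e.
  move=> BE e0; have e20 : 0 < e / 2 by lra.
  have [N uN] := uE _ _ BE e20; exists N => n Nn x Ex.
  have [M uM] := ul x _ e20; have := uM _ (leq_maxr N M).
  have := uN _ _ Nn (leq_maxl N M) x Ex; set m := maxn _ _.
  have := ler_distD (u m x) (u n x) (l x); lra.
have lc : continuous l.
  move=> x; apply/cvgrPdist_lt => e e0; have e30 : 0 < e / 3 by lra.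
  have [E BE xE] := B_local x; have [N uN] := ulE _ _ BE e30.
  have /cvgrPdist_lt/(_ _ e30) uNx := @cts_fun _ _ (u N) x.
  apply: (filterS _ (filterI xE uNx)) => y [Ey /= uxy].
  have := uN N (leqnn N) x (nbhs_singleton xE); have := uN N (leqnn N) y Ey.
  have := ler_distD (u N x) (l x) (l y).
  have := ler_distD (u N y) (u N x) (l y); rewrite (distrC (l x) (u N x)).
  by move: uxy; lra.
exists (mkcts lc : continuousType X R) => e e0; have e20 : 0 < e / 2 by lra.
have [E BE Ee] := dist_small e20; have [N uN] := ulE _ _ BE e20.
exists N => n /uN /(Ee _ (mkcts lc : continuousType X R)); lra.
Qed.

End BornologicalMetric.

Lemma baire_q_point_completely_metrizable (D : set CX) f :
  baire_space CX -> dense D -> q_point D f -> completely_metrizable R CX.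
Proof.
move=> CX_baire dD fD; have [A [BA A_base]] := q_point_countable_base dD fD.
exists (born_dist A); split; first exact: born_dist_metric.
  exact: born_dist_topology.
by apply: born_dist_complete => // x; exact: baire_locally_bounded.
Qed.

End BornologicalConvergence.

Theorem theorem4p6 (R : realType) (X : metricType R) (B S : set_system X)
    (X_nonempty : [set: X] !=set0) (B_bornology : bornology B)
    (S_closed_base : closed_base B S) :
  [<-> completely_metrizable R (C_born R X B);
       sieve_complete (C_born R X B);
       almost_complete (C_born R X B);
       pseudo_complete (C_born R X B) /\ sigma_space (C_born R X B);
       pseudo_complete (C_born R X B) /\
       exists2 D : set (C_born R X B), dense D & exists f, q_point D f].
Proof.
have C_regular : regular_space (C_born R X B) by exact: uniform_regular.
have C_nonempty : [set: C_born R X B] !=set0.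
  by exists (mkcts (@cst_continuous X R 0%R) : continuousType X R).
have C_pseudo_baire : pseudo_complete (C_born R X B) -> baire_space (C_born R X B).
  exact: (pseudo_complete_baire C_regular).
have core (D : set (C_born R X B)) f : baire_space (C_born R X B) -> dense D ->
    q_point D f -> completely_metrizable R (C_born R X B).
  exact: (baire_q_point_completely_metrizable X_nonempty B_bornology S_closed_base).
have denseT : dense [set: C_born R X B] by move=> O O0 _; rewrite setIT.
tfae.
- by move=> [d [dm dt dc]]; exact: complete_metric_sieve_complete dm dt dc.
- move=> [I [U [p [[Ucov Uch] oU cU]]]]; exists I, U, p; split=> //; split=> [n|n i].
    by rewrite Ucov.
  by rewrite -Uch; split=> //; exact: subset_closure.
(* This implication passes through a complete metric. The previous lemma on almost complete spaces
   serves twice: with arbitrary [G] for the Baire property, and with trivial [G] for a q-point. *)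
- move=> C_almost.
  have C_baire : baire_space (C_born R X B).
    move=> G oG dG; have [f Gf _] :=
      almost_complete_q_point C_regular C_nonempty C_almost oG dG.
    by exists f.
  have [f _ fT] := almost_complete_q_point C_regular C_nonempty C_almost
    (fun=> openT) (fun=> denseT).
  have [d [dm dt dc]] := core _ _ C_baire denseT fT.
  split; first exact: complete_metric_pseudo_complete dm dt dc.
  exact: metric_sigma_space dm dt.
- move=> [C_pseudo C_sigma]; split=> //; exists setT => //.
  exact: sigma_baire_q_point (C_pseudo_baire C_pseudo) C_sigma.
- by move=> [/C_pseudo_baire C_baire [D dD [f fD]]]; exact: core C_baire dD fD.
Qed.
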